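(* Let $\mathbb{T}$ be a time scale, let $a,b\in\mathbb{T}$ with $a<b$, and let $f:[a,b]_{\mathbb{T}}\to\mathbb{R}_{\mathcal{F}}$ be a function. Then $f$ is FHK $\Delta$-integrable on $[a,b]_{\mathbb{T}}$ if and only if the real-valued functions $x\mapsto\underline{f(x)^{\alpha}}$ and $x\mapsto\overline{f(x)^{\alpha}}$ are HK $\Delta$-integrable on $[a,b]_{\mathbb{T}}$ for all $\alpha\in[0,1]$ uniformly in $\alpha$; that is, these functions are HK $\Delta$-integrable for every $\alpha\in[0,1]$ and for each $\epsilon>0$ there exists a single $\Delta$-gauge $\delta$ on $[a,b]_{\mathbb{T}}$, independent of $\alpha$, such that $$\left|S(\underline{f^{\alpha}},D,\delta)-(HK)\int_{[a,b]_{\mathbb{T}}}\underline{f(x)^{\alpha}}\Delta x\right|<\epsilon\quad\text{and}\quad\left|S(\overline{f^{\alpha}},D,\delta)-(HK)\int_{[a,b]_{\mathbb{T}}}\overline{f(x)^{\alpha}}\Delta x\right|<\epsilon$$ for every $\alpha\in[0,1]$ and every $\delta$-fine HK division $D$ of $[a,b]_{\mathbb{T}}$.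
   Context: Fuzzy numbers: $\mathbb{R}_{\mathcal{F}}$ is the set of functions $u:\mathbb{R}\to[0,1]$ that are normal ($u(x_0)=1$ for some $x_0$), fuzzy convex ($u(\lambda x_1+(1-\lambda)x_2)\ge\min\{u(x_1),u(x_2)\}$ for all $x_1,x_2\in\mathbb{R}$, $\lambda\in(0,1)$), upper semicontinuous, and such that $[u]^0:=\overline{\{x:u(x)>0\}}$ is compact. For $\alpha\in(0,1]$, $[u]^\alpha:=\{x:u(x)\ge\alpha\}$; for each $\alpha\in[0,1]$ this is a compact interval, written $[u]^\alpha=[\underline{u^\alpha},\overline{u^\alpha}]$. Addition and real scalar multiplication are defined levelwise: $[u+v]^\alpha=[u]^\alpha+[v]^\alpha$, $[\lambda\odot u]^\alpha=\lambda[u]^\alpha$ for all $\alpha\in[0,1]$. The metric is $\mathbf{D}(u,v)=\sup_{\alpha\in[0,1]}\max\{|\underline{u^\alpha}-\underline{v^\alpha}|,|\overline{u^\alpha}-\overline{v^\alpha}|\}$. Time scales: a time scale $\mathbb{T}$ is a nonempty closed subset of $\mathbb{R}$; $[a,b]_{\mathbb{T}}=\{x\in\mathbb{T}:a\le x\le b\}$, and similarly for other intervals. $\sigma(x)=\inf\{y\in\mathbb{T}:y>x\}$ (with $\sigma(\sup\mathbb{T})=\sup\mathbb{T}$ if finite), $\mu(x)=\sigma(x)-x$. A $\Delta$-gauge on $[a,b]_{\mathbb{T}}$ is a pair $\delta=(\delta_L,\delta_R)$ of real functions on $[a,b]_{\mathbb{T}}$ with $\delta_L>0$ on $(a,b]_{\mathbb{T}}$,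 $\delta_R>0$ on $[a,b)_{\mathbb{T}}$, $\delta_L(a)\ge0$, $\delta_R(b)\ge0$, and $\delta_R(\xi)\ge\mu(\xi)$ for all $\xi\in[a,b)_{\mathbb{T}}$. A $\delta$-fine HK division of $[a,b]_{\mathbb{T}}$ is a finite collection $D=\{([x_{i-1},x_i]_{\mathbb{T}},\xi_i)\}_{i=1}^n$ with $a=x_0<x_1<\dots<x_n=b$ points of $\mathbb{T}$, $\xi_i\in[x_{i-1},x_i]_{\mathbb{T}}$, and $\xi_i-\delta_L(\xi_i)\le x_{i-1}<x_i\le\xi_i+\delta_R(\xi_i)$ for each $i$. Write $\Delta x_i=x_i-x_{i-1}$ and $S(g,D,\delta)=\sum_{i=1}^n g(\xi_i)\Delta x_i$ for $g$ with values in $\mathbb{R}_{\mathcal{F}}$ or in $\mathbb{R}$. FHK $\Delta$-integrability: $f:[a,b]_{\mathbb{T}}\to\mathbb{R}_{\mathcal{F}}$ is FHK $\Delta$-integrable on $[a,b]_{\mathbb{T}}$ with integral $\tilde A=(FHK)\int_{[a,b]_{\mathbb{T}}}f(x)\Delta x\in\mathbb{R}_{\mathcal{F}}$ if for each $\epsilon>0$ there is a $\Delta$-gauge $\delta$ on $[a,b]_{\mathbb{T}}$ with $\mathbf{D}(S(f,D,\delta),\tilde A)<\epsilon$ for every $\delta$-fine HK division $D$ of $[a,b]_{\mathbb{T}}$. A real function $g:[a,b]_{\mathbb{T}}\to\mathbb{R}$ is HK $\Delta$-integrable with integral $A=(HK)\int_{[a,b]_{\mathbb{T}}}g(x)\Delta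 x\in\mathbb{R}$ if for each $\epsilon>0$ there is a $\Delta$-gauge $\delta$ with $|S(g,D,\delta)-A|<\epsilon$ for every $\delta$-fine HK division $D$. *)

(* Defs.v *)
From HB Require Import structures.
From mathcomp Require Import all_boot all_order all_algebra.
From mathcomp Require Import all_classical all_reals all_analysis.
From mathcomp Require Import lra.

Set Implicit Arguments.
Unset Strict Implicit.
Unset Printing Implicit Defensive.

Import Order.TTheory GRing.Theory Num.Theory.
Import numFieldNormedType.Exports.

Local Open Scope classical_set_scope.
Local Open Scope ring_scope.

Record fuzzy (R : realType) := Fuzzy {
  fuzzy_fun :> R -> R;
  fuzzy_range : forall x, 0 <= fuzzy_fun x <= 1;
  fuzzy_normal : exists x0, fuzzy_fun x0 = 1;
  fuzzy_convex : forall x1 x2 l : R, 0 < l < 1 ->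
    Num.min (fuzzy_fun x1) (fuzzy_fun x2) <=
      fuzzy_fun (l * x1 + (1 - l) * x2);
  fuzzy_usc : forall x c : R, fuzzy_fun x < c ->
    \forall y \near x, fuzzy_fun y < c;
  fuzzy_compact_support : compact (closure [set x | 0 < fuzzy_fun x])
}.

(* Only levels [alpha] in [0, 1] are meaningful. *)
Definition fuzzy_level (R : realType) (u : fuzzy R) (alpha : R) : set R :=
  if alpha == 0 then closure [set x | 0 < u x] else [set x | alpha <= u x].

Definition fuzzy_lower (R : realType) (u : fuzzy R) (alpha : R) : R :=
  inf (fuzzy_level u alpha).

Definition fuzzy_upper (R : realType) (u : fuzzy R) (alpha : R) : R :=
  sup (fuzzy_level u alpha).

Section FuzzyNumbers.
Context {R : realType}.
Implicit Types (u v w : fuzzy R) (alpha beta x y : R).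

Lemma fuzzy_itv u x y z m : x <= y <= z -> m <= u x -> m <= u z -> m <= u y.
Proof.
move=> /andP[]; rewrite le_eqVlt => /predU1P[->//|xy].
rewrite le_eqVlt => /predU1P[->//|yz] mx mz.
have xz : 0 < z - x by lra.
have l01 : 0 < (z - y) / (z - x) < 1.
  by apply/andP; split; [apply: divr_gt0; lra|rewrite ltr_pdivrMr//; lra].
have := fuzzy_convex u x z l01.
have -> : (z - y) / (z - x) * x + (1 - (z - y) / (z - x)) * z = y.
  have e : (z - y) / (z - x) * (z - x) = z - y by rewrite divfK ?gt_eqF.
  by move: e; set t := _ / _ => e; nra.
by apply: le_trans; rewrite le_min mx.
Qed.

Lemma is_interval_fuzzy_level u alpha : is_interval (fuzzy_level u alpha).
Proof.
rewrite /fuzzy_level; case: ifPn => _.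
  apply/connected_intervalP/connected_closure/connected_intervalP.
  move=> x z /= ux uz y xyz.
  have xm : Num.min (u x) (u z) <= u x by rewrite ge_min lexx.
  have zm : Num.min (u x) (u z) <= u z by rewrite ge_min lexx orbT.
  by apply: lt_le_trans (fuzzy_itv xyz xm zm); rewrite lt_min ux.
by move=> x z /= ux uz y xyz; exact: (fuzzy_itv xyz).
Qed.

Lemma closed_fuzzy_level u alpha : closed (fuzzy_level u alpha).
Proof.
rewrite /fuzzy_level; case: ifPn => _; first exact: closed_closure.
rewrite -[X in closed X]setCK; apply: open_closedC.
rewrite openE => x /= /negP; rewrite -ltNge => /fuzzy_usc.
by apply: filterS => y; rewrite ltNge => /negP.
Qed.

Lemma fuzzy_level_sub0 u alpha : 0 <= alpha ->
  fuzzy_level u alpha `<=` fuzzy_level u 0.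
Proof.
rewrite /fuzzy_level eqxx => a0; case: ifPn => [_ //|an0] x /= ax.
apply: subset_closure => /=.
by apply: (lt_le_trans _ ax); rewrite lt_neqAle eq_sym an0.
Qed.

Lemma compact_fuzzy_level u alpha : 0 <= alpha -> compact (fuzzy_level u alpha).
Proof.
move=> a0; apply: subclosed_compact (fuzzy_level_sub0 (u := u) a0).
  exact: closed_fuzzy_level.
by rewrite /fuzzy_level eqxx; exact: fuzzy_compact_support.
Qed.

Lemma fuzzy_level_nonempty u alpha : 0 <= alpha <= 1 ->
  fuzzy_level u alpha !=set0.
Proof.
move=> /andP[a0 a1]; have [x ux] := fuzzy_normal u; exists x.
rewrite /fuzzy_level; case: ifPn => _ /=; last by rewrite ux.
by apply: subset_closure => /=; rewrite ux.
Qed.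

Lemma fuzzy_level_has_sup u alpha : 0 <= alpha <= 1 ->
  has_sup (fuzzy_level u alpha).
Proof.
move=> a01; apply: compact_has_sup; first exact: fuzzy_level_nonempty.
by apply: compact_fuzzy_level; case/andP: a01.
Qed.

Lemma fuzzy_level_has_inf u alpha : 0 <= alpha <= 1 ->
  has_inf (fuzzy_level u alpha).
Proof.
move=> /[dup] a01 /andP[a0 _]; split; first exact: fuzzy_level_nonempty.
have [M [_ MA]] := compact_bounded (compact_fuzzy_level (u := u) a0).
exists (- (M + 1)) => y /MA My; rewrite lerNl (le_trans _ (My (M + 1) _))//.
  by rewrite -normrN ler_norm.
by rewrite ltrDl.
Qed.

Lemma fuzzy_levelE u alpha : 0 <= alpha <= 1 ->
  fuzzy_level u alpha = `[fuzzy_lower u alpha, fuzzy_upper u alpha]%classic.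
Proof.
move=> a01; have hs := fuzzy_level_has_sup u a01.
have hi := fuzzy_level_has_inf u a01.
apply/seteqP; split=> x /=.
  move=> ux; rewrite in_itv/=; apply/andP; split.
    by apply: ge_inf ux; exact: hi.2.
  by apply: ub_le_sup ux; exact: hs.2.
rewrite in_itv/= => /andP[lx xr].
have cl : closed (fuzzy_level u alpha) by exact: closed_fuzzy_level.
have inf_in : fuzzy_level u alpha (fuzzy_lower u alpha).
  apply: (itv_closed_infimums hi.1 cl); split; last first.
    by move=> y; exact: lb_le_inf hi.1.
  by apply: ge_inf; exact: hi.2.
have sup_in : fuzzy_level u alpha (fuzzy_upper u alpha).
  by apply/cl/closure_sup; [exact: hs.1|exact: hs.2].
by apply: (is_interval_fuzzy_level inf_in sup_in); rewrite lx.
Qed.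

Lemma fuzzy_level_inj u v :
  (forall alpha, 0 <= alpha <= 1 ->
    fuzzy_level u alpha = fuzzy_level v alpha) ->
  u = v.
Proof.
move=> uv; have le u1 u2 : (forall alpha, 0 <= alpha <= 1 ->
    fuzzy_level u1 alpha = fuzzy_level u2 alpha) -> forall x, u1 x <= u2 x.
  move=> u12 x; have /andP[u0 u1x] := fuzzy_range u1 x.
  have [->|un0] := eqVneq (u1 x) 0; first by have /andP[] := fuzzy_range u2 x.
  have := u12 (u1 x); rewrite u0 u1x => /(_ isT).
  rewrite /fuzzy_level (negPf un0) => /seteqP[/(_ x) /= + _]; exact.
have : fuzzy_fun u = fuzzy_fun v.
  have vu alpha : 0 <= alpha <= 1 -> fuzzy_level v alpha = fuzzy_level u alpha.
    by move=> /uv.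
  by apply/funext => x; apply/le_anti/andP; split; exact: le.
case: u {uv} => f ? ? ? ? ?; case: v => g ? ? ? ? ? /= fg.
by subst g; congr Fuzzy; exact: Prop_irrelevance.
Qed.

(* Goetschel-Voxman: families of endpoints of the levels of a fuzzy number;
   one-sided continuity is phrased through the order. *)
Definition endpoint_family (l r : R -> R) : Prop :=
  [/\ l 1 <= r 1,
      forall alpha beta, 0 <= alpha -> alpha <= beta -> beta <= 1 ->
        l alpha <= l beta /\ r beta <= r alpha,
      forall alpha x, 0 < alpha <= 1 ->
        (forall beta, 0 < beta < alpha -> l beta <= x) -> l alpha <= x,
      forall alpha x, 0 < alpha <= 1 ->
        (forall beta, 0 < beta < alpha -> x <= r beta) -> x <= r alpha &
      forall x,
        ((forall beta, 0 < beta <= 1 -> x <= l beta) -> x <= l 0) /\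
        ((forall beta, 0 < beta <= 1 -> r beta <= x) -> r 0 <= x)].

Lemma endpoint_family_fuzzy (l r : R -> R) : endpoint_family l r ->
  exists u, forall alpha, 0 <= alpha <= 1 ->
    fuzzy_level u alpha = `[l alpha, r alpha]%classic.
Proof.
move=> [lr1 mono lcl lcr rc0].
pose B x := [set b : R | 0 <= b <= 1 /\ (b = 0 \/ l b <= x <= r b)].
pose w x := sup (B x).
have B0 x : B x 0 by split; [rewrite lexx ler01|left].
have Bub x : ubound (B x) 1 by move=> b [/andP[]].
have w0 x : 0 <= w x by apply: ub_le_sup => //; exists 1.
have w1 x : w x <= 1 by apply: ge_sup => //; exists 0.
have wP alpha x : 0 < alpha <= 1 -> (alpha <= w x) = (l alpha <= x <= r alpha).
  move=> /andP[a0 a1]; apply/idP/idP => [aw|xa]; last first.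
    by apply: ub_le_sup; [exists 1|split; [rewrite ltW|right]].
  have key beta : 0 < beta < alpha -> l beta <= x <= r beta.
    move=> /andP[b0 ba].
    have Bx0 : B x !=set0 by exists 0.
    have [g [/andP[g0 g1] Hg] bg] := sup_gt Bx0 (lt_le_trans ba aw).
    case: Hg => [g0'|/andP[lx xr]]; first by move: bg; rewrite g0' ltNge ltW.
    have [h1 h2] := mono beta g (ltW b0) (ltW bg) g1.
    by rewrite (le_trans h1 lx) (le_trans xr h2).
  by rewrite lcl ?lcr ?a0// => beta /key/andP[].
have lr beta : 0 <= beta <= 1 -> l beta <= l 1 /\ r 1 <= r beta.
  by move=> /andP[b0 b1]; exact: mono.
have lr0 beta : 0 <= beta <= 1 -> l 0 <= l beta /\ r beta <= r 0.
  by move=> /andP[b0 b1]; exact: mono.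
have supp : closure [set x | 0 < w x] = `[l 0, r 0]%classic.
  apply/seteqP; split.
    have cl0 : closed `[l 0, r 0]%classic by exact: itv_closed.
    rewrite [X in _ `<=` X](closure_id _).1//.
    apply: closure_subset => x wx; rewrite /= in_itv/=.
    have : l (w x) <= x <= r (w x) by rewrite -wP ?lexx// wx w1.
    have [|h1 h2] := lr0 (w x); first by rewrite w0 w1.
    by move=> /andP[lx xr]; rewrite (le_trans h1 lx) (le_trans xr h2).
  move=> x /=; rewrite in_itv/= => /andP[lx xr] U /nbhs_ballP[e /= e0 eU].
  have [xl1|l1x] := leP x (l 1).
    have [b /andP[b0 b1] lbx] : exists2 b, 0 < b <= 1 & l b < x + e.
      apply: contrapT => H; have [/(_ _)H0 _] := rc0 (x + e).
      have : x + e <= l 0.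
        apply: H0 => b b01; rewrite leNgt; apply/negP => lb.
        by apply: H; exists b.
      by lra.
    have b01 : 0 <= b <= 1 by rewrite ltW.
    have [h1 h2] := lr b b01.
    exists (Num.max x (l b)); split => /=.
      apply: (lt_le_trans b0); rewrite wP ?b0//.
      by rewrite le_max lexx orbT ge_max; apply/andP; split; lra.
    apply: eU; rewrite /ball/= distrC ger0_norm ?subr_ge0 ?le_max ?lexx//.
    by rewrite ltrBlDl gt_max lbx andbT; lra.
  have [b /andP[b0 b1] lbx] : exists2 b, 0 < b <= 1 & x - e < r b.
    apply: contrapT => H; have [_ /(_ _)H0] := rc0 (x - e).
    have : r 0 <= x - e.
      apply: H0 => b b01; rewrite leNgt; apply/negP => lb.
      by apply: H; exists b.
    by lra.
  have b01 : 0 <= b <= 1 by rewrite ltW.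
  have [h1 h2] := lr b b01.
  exists (Num.min x (r b)); split => /=.
    apply: (lt_le_trans b0); rewrite wP ?b0//.
    by rewrite ge_min lexx orbT le_min andbT; apply/andP; split; lra.
  apply: eU; rewrite /ball/= ger0_norm ?subr_ge0 ?ge_min ?lexx//.
  by rewrite ltrBlDl -ltrBlDr lt_min lbx andbT; lra.
have wrange x : 0 <= w x <= 1 by rewrite w0 w1.
have wnormal : exists x0, w x0 = 1.
  exists (l 1); apply/eqP; rewrite eq_le w1 wP ?ltr01 ?lexx//.
have wconvex (x1 x2 t : R) : 0 < t < 1 ->
    Num.min (w x1) (w x2) <= w (t * x1 + (1 - t) * x2).
  move=> /andP[t0 t1]; set m := Num.min _ _.
  have [m0|m0] := leP m 0; first exact: le_trans m0 _.
  have m01 : 0 < m <= 1 by rewrite m0 ge_min w1.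
  have : m <= w x1 by rewrite ge_min lexx.
  have : m <= w x2 by rewrite ge_min lexx orbT.
  by rewrite !wP// => /andP[? ?] /andP[? ?]; apply/andP; split; nra.
have wusc (x c : R) : w x < c -> \forall y \near x, w y < c.
  move=> xc; have [c1|c1] := ltP 1 c.
    by near do exact: le_lt_trans c1.
  have c01 : 0 < c <= 1 by rewrite (le_lt_trans (w0 x) xc).
  have nb : nbhs x (~` `[l c, r c]%classic).
    apply: open_nbhs_nbhs; split; first exact/closed_openC/itv_closed.
    by rewrite /= in_itv/= -wP// leNgt xc.
  by apply: filterS nb => y /=; rewrite in_itv/= -wP// ltNge => /negP.
have wcompact : compact (closure [set x | 0 < w x]).
  by rewrite supp; exact: segment_compact.
exists (Fuzzy wrange wnormal wconvex wusc wcompact) => alpha /andP[a0 a1].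
rewrite /fuzzy_level/=; case: ifPn => [/eqP ->//|an0].
apply/seteqP; split => x /=; rewrite in_itv/= wP//;
  by rewrite lt_neqAle eq_sym an0 a0 a1.
Unshelve. all: by end_near. Qed.

Lemma fuzzy_lower_upper u alpha : 0 <= alpha <= 1 ->
  fuzzy_lower u alpha <= fuzzy_upper u alpha.
Proof.
move=> a01; have [x] := fuzzy_level_nonempty u a01.
by rewrite fuzzy_levelE//= in_itv/= => /andP[]; exact: le_trans.
Qed.

Lemma fuzzy_level_pos u alpha x : 0 < alpha <= 1 ->
  (alpha <= u x) = (fuzzy_lower u alpha <= x <= fuzzy_upper u alpha).
Proof.
move=> /andP[a0 a1]; have a01 : 0 <= alpha <= 1 by rewrite ltW.
have := fuzzy_levelE u a01; rewrite {1}/fuzzy_level gt_eqF//.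
move=> /seteqP[/(_ x) /= + /(_ x) /=]; rewrite !in_itv/= => h1 h2.
by apply/idP/idP.
Qed.

Lemma fuzzy_level_sub u alpha beta : 0 <= alpha -> alpha <= beta ->
  fuzzy_level u beta `<=` fuzzy_level u alpha.
Proof.
rewrite le_eqVlt => /predU1P[<-|a0 ab]; first exact: fuzzy_level_sub0.
rewrite /fuzzy_level !gt_eqF//; last exact: lt_le_trans ab.
by move=> x /=; exact: le_trans.
Qed.

Lemma le_forall_lt x y : (forall z, z < x -> z <= y) -> x <= y.
Proof.
move=> H; rewrite leNgt; apply/negP => yx.
have : (x + y) / 2 <= y by apply: H; lra.
by lra.
Qed.

Lemma endpoint_family_of_fuzzy u :
  endpoint_family (fuzzy_lower u) (fuzzy_upper u).
Proof.
have mono alpha beta : 0 <= alpha -> alpha <= beta -> beta <= 1 ->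
    fuzzy_lower u alpha <= fuzzy_lower u beta /\
    fuzzy_upper u beta <= fuzzy_upper u alpha.
  move=> a0 ab b1; have b01 : 0 <= beta <= 1 by rewrite (le_trans a0 ab).
  have a01 : 0 <= alpha <= 1 by rewrite a0 (le_trans ab b1).
  have lu := fuzzy_lower_upper u b01.
  have := fuzzy_level_sub (u := u) a0 ab; rewrite !fuzzy_levelE// => sub.
  have := sub (fuzzy_lower u beta); have := sub (fuzzy_upper u beta).
  rewrite /= !in_itv/= !lexx lu => /(_ isT)/andP[_ ->] /(_ isT)/andP[-> _].
  by [].
split=> //.
- by apply: fuzzy_lower_upper; rewrite ler01 lexx.
- move=> alpha x /[dup] a01' /andP[a0 a1] H.
  have a01 : 0 <= alpha <= 1 by rewrite ltW.
  set y := Num.min x (fuzzy_upper u alpha).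
  suff : alpha <= u y.
    by rewrite fuzzy_level_pos// le_min => /andP[/andP[]].
  apply: le_forall_lt => b ba; have [b0|b0] := leP b 0.
    by rewrite (le_trans b0)//; case/andP: (fuzzy_range u y).
  have [h1 h2] := mono b alpha (ltW b0) (ltW ba) a1.
  rewrite fuzzy_level_pos ?b0 ?(le_trans (ltW ba))//.
  rewrite le_min H ?b0//= (le_trans h1 (fuzzy_lower_upper u a01))/=.
  by rewrite ge_min h2 orbT.
- move=> alpha x /[dup] a01' /andP[a0 a1] H.
  have a01 : 0 <= alpha <= 1 by rewrite ltW.
  set y := Num.max x (fuzzy_lower u alpha).
  suff : alpha <= u y.
    by rewrite fuzzy_level_pos// ge_max => /andP[_ /andP[]].
  apply: le_forall_lt => b ba; have [b0|b0] := leP b 0.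
    by rewrite (le_trans b0)//; case/andP: (fuzzy_range u y).
  have [h1 h2] := mono b alpha (ltW b0) (ltW ba) a1.
  rewrite fuzzy_level_pos ?b0 ?(le_trans (ltW ba))//.
  rewrite ge_max H ?b0//= (le_trans (fuzzy_lower_upper u a01) h2) andbT.
  by rewrite le_max h1 orbT.
- have supp y : 0 < u y -> 0 < u y <= 1.
    by move=> ->; case/andP: (fuzzy_range u y).
  move=> x; split=> H.
    apply: lb_le_inf; first by apply: fuzzy_level_nonempty; rewrite lexx ler01.
    rewrite /fuzzy_level eqxx => y uy.
    suff : closure [set z | x <= z] y.
      by rewrite -(closure_id _).1//; exact: closed_ge.
    apply: closure_subset uy => z /= /supp uz; apply: le_trans (H _ uz) _.
    by have := lexx (u z); rewrite fuzzy_level_pos// => /andP[].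
  apply: ge_sup; first by apply: fuzzy_level_nonempty; rewrite lexx ler01.
  rewrite /fuzzy_level eqxx => y uy.
  suff : closure [set z | z <= x] y.
    by rewrite -(closure_id _).1//; exact: closed_le.
  apply: closure_subset uy => z /= /supp uz; apply: le_trans _ (H _ uz).
  by have := lexx (u z); rewrite fuzzy_level_pos// => /andP[].
Qed.

Lemma itv_addE (a b c d : R) : a <= b -> c <= d ->
  [set x + y | x in `[a, b] & y in `[c, d]] = `[a + c, b + d]%classic.
Proof.
move=> ab cd; apply/seteqP; split=> z /=.
  move=> [x]; rewrite in_itv/= => /andP[? ?] [y].
  rewrite in_itv/= => /andP[? ?] <-.
  by rewrite in_itv/=; apply/andP; split; lra.
rewrite in_itv/=.
move=> /andP[z1 z2]; have [bz|zb] := leP b (z - c).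
  exists b; first by rewrite /= in_itv/= ab lexx.
  by exists (z - b); [rewrite /= in_itv/=; apply/andP; split; lra|lra].
exists (z - c); first by rewrite /= in_itv/=; apply/andP; split; lra.
by exists c; [rewrite /= in_itv/= lexx cd|lra].
Qed.

Lemma itv_scaleE (k a b : R) : a <= b ->
  [set k * x | x in `[a, b]] =
  `[Num.min (k * a) (k * b), Num.max (k * a) (k * b)]%classic.
Proof.
move=> ab; have [k0|k0|->] := ltgtP k 0.
- have kba : k * b <= k * a by rewrite ler_nM2l.
  rewrite (min_r kba) (max_l kba); apply/seteqP; split=> z /=.
    by move=> [x + <-]; rewrite !in_itv/= !ler_nM2l// andbC.
  rewrite in_itv/= => zk; exists (k^-1 * z); last by rewrite mulVKf ?lt_eqF.
  by rewrite in_itv/= -(ler_nM2l k0) -[X in _ && X](ler_nM2l k0)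
    mulVKf ?lt_eqF// andbC.
- have kba : k * a <= k * b by rewrite ler_pM2l.
  rewrite (min_l kba) (max_r kba); apply/seteqP; split=> z /=.
    by move=> [x + <-]; rewrite !in_itv/= !ler_pM2l.
  rewrite in_itv/= => zk; exists (k^-1 * z); last by rewrite mulVKf ?gt_eqF.
  by rewrite in_itv/= -(ler_pM2l k0) -[X in _ && X](ler_pM2l k0)
    mulVKf ?gt_eqF.
- rewrite !mul0r minxx maxxx set_itv1; apply/seteqP; split=> z /=.
    by move=> [x _ <-]; rewrite mul0r.
  by move=> ->; exists a; rewrite ?mul0r// in_itv/= lexx.
Qed.

Lemma endpoint_familyD (l1 r1 l2 r2 : R -> R) :
  endpoint_family l1 r1 -> endpoint_family l2 r2 ->
  endpoint_family (l1 \+ l2) (r1 \+ r2).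
Proof.
move=> [lr1 m1 lcl1 lcr1 rc1] [lr2 m2 lcl2 lcr2 rc2].
have mono alpha beta : 0 <= alpha -> alpha <= beta -> beta <= 1 ->
    (l1 \+ l2) alpha <= (l1 \+ l2) beta /\ (r1 \+ r2) beta <= (r1 \+ r2) alpha.
  move=> a0 ab b1; have [? ?] := m1 _ _ a0 ab b1; have [? ?] := m2 _ _ a0 ab b1.
  by split; exact: lerD.
split=> //=.
- exact: lerD.
- move=> alpha x /[dup] a01 /andP[a0 a1] H.
  rewrite -lerBrDr; apply: lcl1 => // b /andP[b0 ba].
  rewrite lerBrDr -lerBrDl; apply: lcl2 => // c /andP[c0 ca].
  rewrite lerBrDl; have [bc|cb] := leP b c.
    have [h _] := m1 b c (ltW b0) bc (le_trans (ltW ca) a1).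
    by apply: le_trans (H c _); rewrite ?c0// lerD2r.
  have [h _] := m2 c b (ltW c0) (ltW cb) (le_trans (ltW ba) a1).
  by apply: le_trans (H b _); rewrite ?b0// lerD2l.
- move=> alpha x /[dup] a01 /andP[a0 a1] H.
  rewrite -lerBlDr; apply: lcr1 => // b /andP[b0 ba].
  rewrite lerBlDr -lerBlDl; apply: lcr2 => // c /andP[c0 ca].
  rewrite lerBlDl; have [bc|cb] := leP b c.
    have [_ h] := m1 b c (ltW b0) bc (le_trans (ltW ca) a1).
    by apply: le_trans (H c _) _; rewrite ?c0// lerD2r.
  have [_ h] := m2 c b (ltW c0) (ltW cb) (le_trans (ltW ba) a1).
  by apply: le_trans (H b _) _; rewrite ?b0// lerD2l.
- move=> x; split=> H.
    rewrite -lerBlDr; apply: (rc1 _).1 => b /andP[b0 b1].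
    rewrite lerBlDr -lerBlDl; apply: (rc2 _).1 => c /andP[c0 c1].
    rewrite lerBlDl; have [bc|cb] := leP b c.
      have [h _] := m2 b c (ltW b0) bc c1.
      by apply: le_trans (H b _) _; rewrite ?b0// lerD2l.
    have [h _] := m1 c b (ltW c0) (ltW cb) b1.
    by apply: le_trans (H c _) _; rewrite ?c0// lerD2r.
  rewrite -lerBrDr; apply: (rc1 _).2 => b /andP[b0 b1].
  rewrite lerBrDr -lerBrDl; apply: (rc2 _).2 => c /andP[c0 c1].
  rewrite lerBrDl; have [bc|cb] := leP b c.
    have [_ h] := m2 b c (ltW b0) bc c1.
    by apply: le_trans (H b _); rewrite ?b0// lerD2l.
  have [_ h] := m1 c b (ltW c0) (ltW cb) b1.
  by apply: le_trans (H c _); rewrite ?c0// lerD2r.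
Qed.

Lemma endpoint_family_cst (c : R) : endpoint_family (cst c) (cst c).
Proof.
split=> //= [alpha x /andP[a0 _] /(_ (alpha / 2))|
  alpha x /andP[a0 _] /(_ (alpha / 2))|x]; first by apply; lra.
- by apply; lra.
- by split=> /(_ 1); rewrite ltr01 lexx; exact.
Qed.

Lemma endpoint_familyZ (k : R) (l r : R -> R) : 0 < k ->
  endpoint_family l r ->
  endpoint_family (fun alpha => k * l alpha) (fun alpha => k * r alpha).
Proof.
move=> k0 [lr mono lcl lcr rc0]; split.
- by rewrite ler_pM2l.
- by move=> a b a0 ab b1; rewrite !ler_pM2l//; exact: mono.
- move=> a x a01 H; rewrite -ler_pdivlMl//; apply: lcl => // b /H.
  by rewrite ler_pdivlMl.
- move=> a x a01 H; rewrite -ler_pdivrMl//; apply: lcr => // b /H.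
  by rewrite ler_pdivrMl.
- move=> x; split=> H.
    rewrite -ler_pdivrMl//; apply: (rc0 _).1 => // b /H.
    by rewrite ler_pdivrMl.
  rewrite -ler_pdivlMl//; apply: (rc0 _).2 => // b /H.
  by rewrite ler_pdivlMl.
Qed.

Lemma endpoint_familyN (l r : R -> R) : endpoint_family l r ->
  endpoint_family (fun alpha => - r alpha) (fun alpha => - l alpha).
Proof.
move=> [lr mono lcl lcr rc0]; split.
- by rewrite lerN2.
- by move=> a b a0 ab b1; rewrite !lerN2; have [] := mono _ _ a0 ab b1.
- by move=> a x a01 H; rewrite lerNl; apply: lcr => // b /H; rewrite lerNl.
- by move=> a x a01 H; rewrite lerNr; apply: lcl => // b /H; rewrite lerNr.
- move=> x; split=> H.
    by rewrite lerNr; apply: (rc0 _).2 => // b /H; rewrite lerNr.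
  by rewrite lerNl; apply: (rc0 _).1 => // b /H; rewrite lerNl.
Qed.

Lemma fuzzy_add_exists u v : exists w, forall alpha, 0 <= alpha <= 1 ->
  fuzzy_level w alpha =
    [set x + y | x in fuzzy_level u alpha & y in fuzzy_level v alpha].
Proof.
have := endpoint_familyD (endpoint_family_of_fuzzy u)
  (endpoint_family_of_fuzzy v).
move=> /endpoint_family_fuzzy[w wE]; exists w => alpha a01.
by rewrite wE// !fuzzy_levelE// itv_addE//; exact: fuzzy_lower_upper.
Qed.

Lemma fuzzy_scale_exists (k : R) u : exists w, forall alpha, 0 <= alpha <= 1 ->
  fuzzy_level w alpha = [set k * x | x in fuzzy_level u alpha].
Proof.
suff [w wE] : exists w, forall alpha, 0 <= alpha <= 1 ->
    fuzzy_level w alpha =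
      `[Num.min (k * fuzzy_lower u alpha) (k * fuzzy_upper u alpha),
        Num.max (k * fuzzy_lower u alpha) (k * fuzzy_upper u alpha)]%classic.
  exists w => alpha a01; rewrite wE// fuzzy_levelE// itv_scaleE//.
  exact: fuzzy_lower_upper.
have [k0|k0|->] := ltgtP k 0.
- have nk0 : 0 < - k by rewrite oppr_gt0.
  have := endpoint_familyN (endpoint_familyZ nk0 (endpoint_family_of_fuzzy u)).
  move=> /endpoint_family_fuzzy[w wE]; exists w => alpha a01.
  rewrite wE// !mulNr !opprK.
  have h : k * fuzzy_upper u alpha <= k * fuzzy_lower u alpha.
    by rewrite ler_nM2l//; exact: fuzzy_lower_upper.
  by rewrite (min_r h) (max_l h).
- have := endpoint_familyZ k0 (endpoint_family_of_fuzzy u).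
  move=> /endpoint_family_fuzzy[w wE]; exists w => alpha a01.
  have h : k * fuzzy_lower u alpha <= k * fuzzy_upper u alpha.
    by rewrite ler_pM2l//; exact: fuzzy_lower_upper.
  by rewrite wE// (min_l h) (max_r h).
- have /endpoint_family_fuzzy[w wE] := endpoint_family_cst 0.
  by exists w => alpha a01; rewrite wE// !mul0r minxx maxxx.
Qed.

Lemma fuzzy_zero_exists : exists w : fuzzy R, forall alpha, 0 <= alpha <= 1 ->
  fuzzy_level w alpha = [set 0].
Proof.
have /endpoint_family_fuzzy[w wE] := endpoint_family_cst 0.
by exists w => alpha /wE ->; rewrite set_itv1.
Qed.

(* The levels determine a fuzzy number, so each choice below is unique. *)
Definition fuzzy_zero : fuzzy R := sval (cid fuzzy_zero_exists).

Definition fuzzy_add u v : fuzzy R := sval (cid (fuzzy_add_exists u v)).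

Definition fuzzy_scale (k : R) u : fuzzy R :=
  sval (cid (fuzzy_scale_exists k u)).

Lemma fuzzy_level_zero alpha : 0 <= alpha <= 1 ->
  fuzzy_level fuzzy_zero alpha = [set 0].
Proof. exact: (svalP (cid fuzzy_zero_exists)). Qed.

Lemma fuzzy_level_add u v alpha : 0 <= alpha <= 1 ->
  fuzzy_level (fuzzy_add u v) alpha =
    [set x + y | x in fuzzy_level u alpha & y in fuzzy_level v alpha].
Proof. exact: (svalP (cid (fuzzy_add_exists u v))). Qed.

Lemma fuzzy_level_scale k u alpha : 0 <= alpha <= 1 ->
  fuzzy_level (fuzzy_scale k u) alpha = [set k * x | x in fuzzy_level u alpha].
Proof. exact: (svalP (cid (fuzzy_scale_exists k u))). Qed.

Lemma fuzzy_addA : associative fuzzy_add.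
Proof.
move=> u v w; apply: fuzzy_level_inj => alpha a01; rewrite !fuzzy_level_add//.
apply/seteqP; split=> z.
  move=> [x ux [_ [y vy [t wt <-]] <-]].
  by exists (x + y); [exists x => //; exists y|exists t; rewrite ?addrA].
move=> [_ [x ux [y vy <-]] [t wt <-]].
by exists x => //; exists (y + t); [exists y => //; exists t|rewrite addrA].
Qed.

Lemma fuzzy_addC : commutative fuzzy_add.
Proof.
move=> u v; apply: fuzzy_level_inj => alpha a01; rewrite !fuzzy_level_add//.
by apply/seteqP; split=> z [x ux [y vy <-]]; exists y => //; exists x;
  rewrite // addrC.
Qed.

Lemma fuzzy_add0 : left_id fuzzy_zero fuzzy_add.
Proof.
move=> u; apply: fuzzy_level_inj => alpha a01.
rewrite fuzzy_level_add// fuzzy_level_zero//; apply/seteqP; split=> z.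
  by move=> [_ -> [y uy <-]]; rewrite add0r.
by move=> uz; exists 0 => //; exists z; rewrite ?add0r.
Qed.

HB.instance Definition _ := gen_eqMixin (fuzzy R).
HB.instance Definition _ := gen_choiceMixin (fuzzy R).
HB.instance Definition _ :=
  GRing.isNmodule.Build (fuzzy R) fuzzy_addA fuzzy_addC fuzzy_add0.

Definition fuzzy_dist u v : R :=
  sup [set Num.max `|fuzzy_lower u alpha - fuzzy_lower v alpha|
                   `|fuzzy_upper u alpha - fuzzy_upper v alpha|
      | alpha in `[0, 1]].

Lemma fuzzy_dist_has_sup u v :
  has_sup [set Num.max `|fuzzy_lower u alpha - fuzzy_lower v alpha|
                       `|fuzzy_upper u alpha - fuzzy_upper v alpha|
          | alpha in `[0, 1]].
Proof.
split.
  by exists (Num.max `|fuzzy_lower u 0 - fuzzy_lower v 0|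
                     `|fuzzy_upper u 0 - fuzzy_upper v 0|), 0;
    rewrite //= in_itv/= lexx ler01.
exists (Num.max (fuzzy_upper u 0 - fuzzy_lower v 0)
                (fuzzy_upper v 0 - fuzzy_lower u 0)).
move=> _ [alpha /= + <-]; rewrite in_itv/= => /[dup] a01 /andP[a0 a1].
have bnd w : [/\ fuzzy_lower w 0 <= fuzzy_lower w alpha,
    fuzzy_lower w alpha <= fuzzy_upper w alpha &
    fuzzy_upper w alpha <= fuzzy_upper w 0].
  have [_ mono _ _ _] := endpoint_family_of_fuzzy w.
  have [? ?] := mono 0 alpha (lexx 0) a0 a1.
  by split=> //; exact: fuzzy_lower_upper.
have [? ? ?] := bnd u; have [? ? ?] := bnd v.
set M := Num.max (_ - _) _.
have MA : fuzzy_upper u 0 - fuzzy_lower v 0 <= M by rewrite le_max lexx.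
have MB : fuzzy_upper v 0 - fuzzy_lower u 0 <= M by rewrite le_max lexx orbT.
rewrite ge_max !ler_norml.
by apply/andP; split; apply/andP; split; lra.
Qed.

End FuzzyNumbers.

Section TimeScale.
Context {R : realType}.
Implicit Types (T : set R) (a b x : R).

Definition time_scale T : Prop := T !=set0 /\ closed T.

(* [inf set0 = 0] in the library, hence the case for a right-most point. *)
Definition ts_sigma T x : R :=
  if `[< exists2 y, T y & x < y >] then inf [set y | T y /\ x < y] else sup T.

Definition ts_mu T x : R := ts_sigma T x - x.

(* [(delta_L, delta_R)]; the values outside [[a, b]_T] are irrelevant. *)
Definition delta_gauge T a b (delta : (R -> R) * (R -> R)) : Prop :=
  [/\ forall x, (T `&` `]a, b]) x -> 0 < delta.1 x,
      forall x, (T `&` `[a, b[) x -> 0 < delta.2 x,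
      0 <= delta.1 a,
      0 <= delta.2 b &
      forall x, (T `&` `[a, b[) x -> ts_mu T x <= delta.2 x].

(* Points [x_0, ..., x_n] and tags: [hk_tag D i] belongs to the interval from
   [hk_pt D i] to [hk_pt D i.+1]; values past [n] are irrelevant. *)
Record hk_division := HKDivision {
  hk_size : nat;
  hk_pt : nat -> R;
  hk_tag : nat -> R
}.

Implicit Types D : hk_division.

Definition hk_step D (i : nat) : R := hk_pt D i.+1 - hk_pt D i.

Definition is_hk_division T a b D : Prop :=
  [/\ hk_pt D 0 = a,
      hk_pt D (hk_size D) = b,
      forall i, (i <= hk_size D)%N -> T (hk_pt D i),
      forall i, (i < hk_size D)%N -> hk_pt D i < hk_pt D i.+1 &
      forall i, (i < hk_size D)%N ->
        (T `&` `[hk_pt D i, hk_pt D i.+1]) (hk_tag D i)].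

Definition fine_hk_division T a b (delta : (R -> R) * (R -> R)) D : Prop :=
  is_hk_division T a b D /\
  forall i, (i < hk_size D)%N ->
    hk_tag D i - delta.1 (hk_tag D i) <= hk_pt D i /\
    hk_pt D i.+1 <= hk_tag D i + delta.2 (hk_tag D i).

Definition fuzzy_riemann_sum (f : R -> fuzzy R) D : fuzzy R :=
  \sum_(i < hk_size D) fuzzy_scale (hk_step D i) (f (hk_tag D i)).

Definition riemann_sum (g : R -> R) D : R :=
  \sum_(i < hk_size D) g (hk_tag D i) * hk_step D i.

Definition has_fhk_integral T a b (f : R -> fuzzy R) (A : fuzzy R) : Prop :=
  forall e, 0 < e -> exists2 delta, delta_gauge T a b delta &
    forall D, fine_hk_division T a b delta D ->
      fuzzy_dist (fuzzy_riemann_sum f D) A < e.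

Definition fhk_integrable T a b (f : R -> fuzzy R) : Prop :=
  exists A, has_fhk_integral T a b f A.

Definition has_hk_integral T a b (g : R -> R) (A : R) : Prop :=
  forall e, 0 < e -> exists2 delta, delta_gauge T a b delta &
    forall D, fine_hk_division T a b delta D -> `|riemann_sum g D - A| < e.

Definition hk_integrable T a b (g : R -> R) : Prop :=
  exists A, has_hk_integral T a b g A.

(* Meaningful for integrable [g]; the default value is 0. *)
Definition hk_integral T a b (g : R -> R) : R :=
  xget 0 [set A | has_hk_integral T a b g A].

End TimeScale.

(* Main.v *)
(* Riemann sums commute with the endpoint maps: for each level alpha the
   endpoints of S(f, D) are the Riemann sums of the endpoint functions of f.
   Since the metric is the supremum over alpha of the endpoint distances, FHK
   integrability gives uniform HK integrability at once, once HK integrals are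
   known to be unique; this needs the existence of delta-fine divisions
   (Cousin's lemma on a time scale).  Conversely, the two families of HK
   integrals are uniform limits of endpoint families of fuzzy Riemann sums.
   The Goetschel-Voxman conditions survive uniform limits, so the integrals are
   the endpoints of a fuzzy number, which is the FHK integral. *)
Require Import Defs.
From mathcomp Require Import all_boot all_order all_algebra.
From mathcomp Require Import all_classical all_reals all_analysis.
From mathcomp Require Import lra.

Import Order.TTheory GRing.Theory Num.Theory.
Import numFieldNormedType.Exports.

Local Open Scope classical_set_scope.
Local Open Scope ring_scope.

(** * Level endpoints under the operations, the metric and uniform limits *)

Section FuzzyEndpoints.
Context {R : realType}.
Implicit Types (u v : fuzzy R) (l r : R -> R) (alpha k e : R).

Lemma fuzzy_endpointsE u alpha (x y : R) : x <= y ->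
  fuzzy_level u alpha = `[x, y]%classic ->
  fuzzy_lower u alpha = x /\ fuzzy_upper u alpha = y.
Proof.
by move=> xy E; rewrite /fuzzy_lower /fuzzy_upper E inf_itvcc ?sup_itvcc.
Qed.

Lemma fuzzy_endpoints0 alpha : 0 <= alpha <= 1 ->
  fuzzy_lower (0 : fuzzy R) alpha = 0 /\ fuzzy_upper (0 : fuzzy R) alpha = 0.
Proof.
move=> a01; apply: fuzzy_endpointsE => //.
by rewrite fuzzy_level_zero ?set_itv1.
Qed.

Lemma fuzzy_endpointsD u v alpha : 0 <= alpha <= 1 ->
  fuzzy_lower (u + v) alpha = fuzzy_lower u alpha + fuzzy_lower v alpha /\
  fuzzy_upper (u + v) alpha = fuzzy_upper u alpha + fuzzy_upper v alpha.
Proof.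
move=> a01; have lu := fuzzy_lower_upper u a01.
have lv := fuzzy_lower_upper v a01.
apply: fuzzy_endpointsE; first exact: lerD.
by rewrite fuzzy_level_add// !fuzzy_levelE// itv_addE.
Qed.

(** A nonnegative factor keeps the order of the endpoints; a negative one would swap them. The
    factors met later are steps of divisions. *)
Lemma fuzzy_endpointsZ k u alpha : 0 <= k -> 0 <= alpha <= 1 ->
  fuzzy_lower (fuzzy_scale k u) alpha = k * fuzzy_lower u alpha /\
  fuzzy_upper (fuzzy_scale k u) alpha = k * fuzzy_upper u alpha.
Proof.
move=> k0 a01; have lu := fuzzy_lower_upper u a01.
have klu : k * fuzzy_lower u alpha <= k * fuzzy_upper u alpha.
  exact: ler_wpM2l.
apply: fuzzy_endpointsE => //.
by rewrite fuzzy_level_scale// fuzzy_levelE// itv_scaleE// min_l// max_r.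
Qed.

Lemma fuzzy_dist_endpoints u v alpha : 0 <= alpha <= 1 ->
  `|fuzzy_lower u alpha - fuzzy_lower v alpha| <= fuzzy_dist u v /\
  `|fuzzy_upper u alpha - fuzzy_upper v alpha| <= fuzzy_dist u v.
Proof.
move=> a01; apply/andP; rewrite -ge_max.
apply: ub_le_sup; first exact: (fuzzy_dist_has_sup u v).2.
by exists alpha; rewrite //= in_itv.
Qed.

Lemma fuzzy_dist_le u v e :
  (forall alpha, 0 <= alpha <= 1 ->
    `|fuzzy_lower u alpha - fuzzy_lower v alpha| <= e /\
    `|fuzzy_upper u alpha - fuzzy_upper v alpha| <= e) ->
  fuzzy_dist u v <= e.
Proof.
move=> H; apply: ge_sup; first exact: (fuzzy_dist_has_sup u v).1.
move=> _ [alpha /= + <-]; rewrite in_itv/= => /H[h1 h2].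
by rewrite ge_max h1.
Qed.

(** Every condition of [endpoint_family] concludes with a non-strict inequality, so it suffices to
    prove it up to each [e > 0]; it is then borrowed from a fuzzy number whose endpoints are
    [e / 2]-close at all levels. *)
Lemma endpoint_family_uniform_limit l r :
  (forall e, 0 < e -> exists u, forall alpha, 0 <= alpha <= 1 ->
    `|fuzzy_lower u alpha - l alpha| < e /\
    `|fuzzy_upper u alpha - r alpha| < e) ->
  endpoint_family l r.
Proof.
move=> H.
have approx e : 0 < e -> exists2 u,
    endpoint_family (fuzzy_lower u) (fuzzy_upper u) &
    forall alpha, 0 <= alpha <= 1 ->
      [/\ fuzzy_lower u alpha < l alpha + e / 2,
          l alpha < fuzzy_lower u alpha + e / 2,
          fuzzy_upper u alpha < r alpha + e / 2 &
          r alpha < fuzzy_upper u alpha + e / 2].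
  move=> e0; have e20 : 0 < e / 2 by lra.
  have [u uP] := H _ e20; exists u; first exact: endpoint_family_of_fuzzy.
  move=> alpha /uP[]; rewrite !ltr_norml => /andP[? ?] /andP[? ?].
  by split; lra.
split.
- apply/ler_addgt0Pr => e /approx[u [? _ _ _ _] /(_ 1)].
  by rewrite ler01 lexx => /(_ isT)[]; lra.
- move=> alpha beta a0 ab b1.
  have a01 : 0 <= alpha <= 1 by rewrite a0 (le_trans ab).
  have b01 : 0 <= beta <= 1 by rewrite b1 (le_trans a0).
  split; apply/ler_addgt0Pr => e /approx[u [_ mono _ _ _] uP];
    have [? ?] := mono _ _ a0 ab b1;
    by have [? ? ? ?] := uP _ a01; have [? ? ? ?] := uP _ b01; lra.
- move=> alpha x /[dup] ap /andP[a0 a1] Hx.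
  apply/ler_addgt0Pr => e /approx[u [_ _ lcl _ _] uP].
  have a01 : 0 <= alpha <= 1 by rewrite (ltW a0).
  have [_ ? _ _] := uP _ a01.
  (* One [e / 2] pays for passing from [l] to [u] at the levels below [alpha], the other for
     returning to [l] at [alpha]. *)
  suff : fuzzy_lower u alpha <= x + e / 2 by lra.
  apply: lcl => // beta /[dup] /Hx ? /andP[b0 ba].
  have b01 : 0 <= beta <= 1 by rewrite (ltW b0) (le_trans (ltW ba)).
  by have [? _ _ _] := uP _ b01; lra.
- move=> alpha x /[dup] ap /andP[a0 a1] Hx.
  apply/ler_addgt0Pr => e /approx[u [_ _ _ lcr _] uP].
  have a01 : 0 <= alpha <= 1 by rewrite (ltW a0).
  have [_ _ ? _] := uP _ a01.
  suff : x - e / 2 <= fuzzy_upper u alpha by lra.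
  apply: lcr => // beta /[dup] /Hx ? /andP[b0 ba].
  have b01 : 0 <= beta <= 1 by rewrite (ltW b0) (le_trans (ltW ba)).
  by have [_ _ _ ?] := uP _ b01; lra.
- have z01 : 0 <= (0 : R) <= 1 by rewrite lexx ler01.
  move=> x; split=> Hx;
    apply/ler_addgt0Pr => e /approx[u [_ _ _ _ rc0] uP];
    have [? ? ? ?] := uP _ z01.
    suff : x - e / 2 <= fuzzy_lower u 0 by lra.
    apply: (rc0 _).1 => beta /[dup] /Hx ? /andP[b0 b1].
    have b01 : 0 <= beta <= 1 by rewrite (ltW b0).
    by have [_ ? _ _] := uP _ b01; lra.
  suff : fuzzy_upper u 0 <= x + e / 2 by lra.
  apply: (rc0 _).2 => beta /[dup] /Hx ? /andP[b0 b1].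
  have b01 : 0 <= beta <= 1 by rewrite (ltW b0).
  by have [_ _ ? _] := uP _ b01; lra.
Qed.

End FuzzyEndpoints.

(** * Fine divisions of a time scale, uniqueness of the HK integral, and Riemann sums *)

Section HKDivisions.
Context {R : realType}.
Implicit Types (T : set R) (a b x : R) (g : R -> R) (D : hk_division (R := R)).
Implicit Types (delta : (R -> R) * (R -> R)).

Lemma fine_hk_division_rcons T a delta x y t D :
  fine_hk_division T a x delta D -> T y -> x < y ->
  (T `&` `[x, y]) t -> t - delta.1 t <= x -> y <= t + delta.2 t ->
  exists D', fine_hk_division T a y delta D'.
Proof.
case: D => n p s [[/= p0 pn Tp ltp sp] fine] Ty xy xty tx yt.
exists (HKDivision n.+1 (fun i => if (i <= n)%N then p i else y)
  (fun i => if (i < n)%N then s i else t)).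
split; [split => //=|move=> i /=].
- by rewrite ltnn.
- by move=> i _; case: ifP => // /Tp.
- by move=> i; rewrite ltnS; case: ltngtP => // [/ltp//|-> _]; rewrite pn.
- by move=> i; rewrite ltnS; case: ltngtP => // [/sp//|-> _]; rewrite pn.
- by rewrite ltnS; case: ltngtP => // [/fine//|-> _]; rewrite pn.
Qed.

(** The gauge always lets one advance from [x]: at a right-scattered point it reaches the successor
    because it dominates [ts_mu], and at a right-dense point its positivity suffices. *)
Lemma ts_next_le T a b delta x : closed T -> T b ->
  delta_gauge T a b delta -> T x -> a <= x < b ->
  exists y, [/\ T y, x < y <= b & y <= x + delta.2 x].
Proof.
move=> clT Tb [_ d2 _ _ dmu] Tx axb; have /andP[ax xb] := axb.
have Txab : (T `&` `[a, b[) x by split=> //=; rewrite in_itv.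
have d0 := d2 _ Txab; have := dmu _ Txab; rewrite lerBlDl.
rewrite /ts_sigma; case: asboolP => [_|]; last by case; exists b.
set A := [set y | T y /\ x < y] => Ad.
have infA : has_inf A by split; [exists b|exists x => y [_ /ltW]].
have xinf : x <= inf A by apply: lb_le_inf infA.1 _ => y [_ /ltW].
have infb : inf A <= b by apply: ge_inf infA.2 _ _.
have [xi|ix] := ltP x (inf A).
  exists (inf A); rewrite xi infb; split=> //.
  (* [A] is cut out by a strict inequality; the closed set [B] contains it and has the same infimum,
     so [inf A] lies in [T]. *)
  pose B := T `&` [set y | inf A <= y].
  have AB y : A y -> B y.
    by move=> Ay; split; [case: Ay|exact: ge_inf infA.2 _ Ay].
  have clB : closed B by apply: closedI => //; exact: closed_ge.
  suff [] : B (inf A) by [].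
  apply: (@itv_closed_infimums _ _ B) => //; first by exists b; exact: AB.
  split=> [y []//|y lby]; apply: lb_le_inf infA.1 _ => z /AB; exact: lby.
(* Right-dense case: [inf A <= x], so some point of [A] precedes [x + delta.2 x]. If it overshoots
   [b], then [b] itself is within reach. *)
have [y [Ty xy] yd] : exists2 y, A y & y < x + delta.2 x.
  by apply: inf_lt infA.1 _; lra.
have [yb|by'] := leP y b; first by exists y; rewrite xy yb (ltW yd).
by exists b; rewrite xb lexx (le_trans (ltW by') (ltW yd)).
Qed.

(** Cousin's lemma: the supremum [c] of the points up to which a fine division exists is itself such
    a point, and no such point below [b] can be the last. *)
Lemma fine_hk_division_exists T a b delta : closed T -> T a -> T b -> a < b ->
  delta_gauge T a b delta -> exists D, fine_hk_division T a b delta D.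
Proof.
move=> clT Ta Tb ab dg; have [d1 d2 d1a d2b _] := dg.
pose S := [set x | [/\ T x, a <= x <= b &
  exists D, fine_hk_division T a x delta D]].
have Sa : S a.
  split; rewrite ?lexx ?ltW//.
  (* The degenerate interval at [a] has the division with no pieces. *)
  exists (HKDivision 0 (cst a) (cst a)); split; last by [].
  by split.
have supS : has_sup S by split; [exists a|exists b => x [_ /andP[]]].
set c := sup S.
have ac : a <= c by exact: ub_le_sup supS.2 _ _.
have cb : c <= b by apply: ge_sup supS.1 _ => x [_ /andP[]].
have Tc : T c.
  rewrite (closure_id T).1//; apply: (@closure_subset _ S) => [x []//|].
  exact: closure_sup supS.1 supS.2.
have Sc : S c.
  have [->//|ac'] := eqVneq c a.
  have {}ac' : a < c by rewrite lt_neqAle eq_sym ac'.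
  have d1c : 0 < delta.1 c by apply: d1; split=> //=; rewrite in_itv/= ac'.
  have d2c : 0 <= delta.2 c.
    have [->//|cb'] := eqVneq c b.
    by apply/ltW/d2; split=> //=; rewrite in_itv/= ac lt_neqAle cb'.
  (* Some reachable [x] lies within [delta.1 c] of [c]; the piece from [x] to [c], tagged at [c],
     closes the gap. *)
  have [x Sx cx] := sup_adherent d1c supS.
  have := ub_le_sup supS.2 Sx; rewrite -/c le_eqVlt => /predU1P[<-//|xc].
  case: Sx => Tx axb [D fD]; split=> //; first by rewrite ac.
  apply: (fine_hk_division_rcons T a delta x c c D) => //.
  - by split=> //=; rewrite in_itv/= lexx ltW.
  - exact: ltW.
  - by rewrite lerDl.
have [<-|cb'] := eqVneq c b; first by case: Sc.
have {}cb' : c < b by rewrite lt_neqAle cb'.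
have acb : a <= c < b by rewrite ac.
(* If [c < b], a piece tagged at its left end [c] leads beyond the supremum. *)
have [y [Ty /andP[cy yb] yd]] := ts_next_le T a b delta c clT Tb dg Tc acb.
have d1c : 0 <= delta.1 c.
  have [->//|ac'] := eqVneq c a.
  by apply/ltW/d1; split=> //=; rewrite in_itv/= cb lt_neqAle eq_sym ac' ac.
have Sy : S y.
  case: Sc => _ _ [D fD]; split=> //; first by rewrite yb (le_trans ac (ltW cy)).
  apply: (fine_hk_division_rcons T a delta c y c D) => //.
    by split=> //=; rewrite in_itv/= lexx ltW.
  by rewrite gerDl oppr_le0.
by have := ub_le_sup supS.2 Sy; rewrite leNgt cy.
Qed.

Lemma delta_gauge_min T a b delta delta' :
  delta_gauge T a b delta -> delta_gauge T a b delta' ->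
  exists2 eta, delta_gauge T a b eta &
    forall D, fine_hk_division T a b eta D ->
      fine_hk_division T a b delta D /\ fine_hk_division T a b delta' D.
Proof.
move=> [p1 p2 p3 p4 p5] [q1 q2 q3 q4 q5].
exists (delta.1 \min delta'.1, delta.2 \min delta'.2).
  split=> /=; rewrite ?le_min ?p3 ?q3 ?p4 ?q4//.
  - by move=> x xab; rewrite lt_min p1 ?q1.
  - by move=> x xab; rewrite lt_min p2 ?q2.
  - by move=> x xab; rewrite le_min p5 ?q5.
have minl (x y : R) : Num.min x y <= x by rewrite ge_min lexx.
have minr (x y : R) : Num.min x y <= y by rewrite ge_min lexx orbT.
move=> D [hD fD]; split; split=> // i /fD[/= h1 h2]; split.
- by apply: le_trans h1; rewrite lerD2l lerN2.
- by apply: (le_trans h2); rewrite lerD2l.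
- by apply: le_trans h1; rewrite lerD2l lerN2.
- by apply: (le_trans h2); rewrite lerD2l.
Qed.

(** A single division fine for both gauges gives a sum close to [A] and to [B]; Cousin's lemma
    provides it. *)
Lemma has_hk_integral_unique T a b g A B : closed T -> T a -> T b -> a < b ->
  has_hk_integral T a b g A -> has_hk_integral T a b g B -> A = B.
Proof.
move=> clT Ta Tb ab hA hB; apply/eqP; rewrite -subr_eq0 -normr_le0.
apply/ler_addgt0Pr => e e0; have e20 : 0 < e / 2 by lra.
have [d dg dP] := hA _ e20; have [d' dg' dP'] := hB _ e20.
have [eta etag /(_ _)etaP] := delta_gauge_min T a b d d' dg dg'.
have [D /etaP[/dP + /dP']] := fine_hk_division_exists _ _ _ _ clT Ta Tb ab etag.
by rewrite !ltr_norml ler_norml => /andP[? ?] /andP[? ?]; apply/andP; split; lra.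
Qed.

Lemma hk_integralE T a b g A : closed T -> T a -> T b -> a < b ->
  has_hk_integral T a b g A -> hk_integral T a b g = A.
Proof.
move=> clT Ta Tb ab hA; apply: xget_unique => // B hB.
exact: has_hk_integral_unique hB hA.
Qed.

(** The endpoint maps are additive, and they commute with scaling because the steps are positive. *)
Lemma fuzzy_riemann_sum_endpoints T a b (f : R -> fuzzy R) D alpha :
  is_hk_division T a b D -> 0 <= alpha <= 1 ->
  fuzzy_lower (fuzzy_riemann_sum f D) alpha =
    riemann_sum (fun x => fuzzy_lower (f x) alpha) D /\
  fuzzy_upper (fuzzy_riemann_sum f D) alpha =
    riemann_sum (fun x => fuzzy_upper (f x) alpha) D.
Proof.
move=> [_ _ _ step _] a01; rewrite /fuzzy_riemann_sum /riemann_sum.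
split.
  rewrite (big_morph (fun u : fuzzy R => fuzzy_lower u alpha)
    (fun u v => (fuzzy_endpointsD u v alpha a01).1)
    (fuzzy_endpoints0 alpha a01).1).
  apply: eq_bigr => i _; rewrite mulrC.
  by rewrite (fuzzy_endpointsZ _ _ _ _ a01).1// subr_ge0 ltW// step.
rewrite (big_morph (fun u : fuzzy R => fuzzy_upper u alpha)
  (fun u v => (fuzzy_endpointsD u v alpha a01).2)
  (fuzzy_endpoints0 alpha a01).2).
apply: eq_bigr => i _; rewrite mulrC.
by rewrite (fuzzy_endpointsZ _ _ _ _ a01).2// subr_ge0 ltW// step.
Qed.

End HKDivisions.

(** * Passing between the fuzzy integral and the integrals of its endpoints *)

Theorem theorem7 (R : realType) (T : set R) (a b : R) (f : R -> fuzzy R)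
    (hT : time_scale T) (ha : T a) (hb : T b) (hab : a < b) :
  fhk_integrable T a b f <->
  (forall alpha : R, 0 <= alpha <= 1 ->
     hk_integrable T a b (fun x => fuzzy_lower (f x) alpha) /\
     hk_integrable T a b (fun x => fuzzy_upper (f x) alpha)) /\
  (forall e : R, 0 < e ->
     exists2 delta : (R -> R) * (R -> R), delta_gauge T a b delta &
     forall (alpha : R) (D : hk_division),
       0 <= alpha <= 1 -> fine_hk_division T a b delta D ->
       `|riemann_sum (fun x => fuzzy_lower (f x) alpha) D
         - hk_integral T a b (fun x => fuzzy_lower (f x) alpha)| < e /\
       `|riemann_sum (fun x => fuzzy_upper (f x) alpha) D
         - hk_integral T a b (fun x => fuzzy_upper (f x) alpha)| < e).
Proof.
have clT := hT.2.
split=> [[A fA]|[_ unif]].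
  have key e : 0 < e -> exists2 delta, delta_gauge T a b delta &
      forall alpha D, 0 <= alpha <= 1 -> fine_hk_division T a b delta D ->
      `|riemann_sum (fun x => fuzzy_lower (f x) alpha) D
        - fuzzy_lower A alpha| < e /\
      `|riemann_sum (fun x => fuzzy_upper (f x) alpha) D
        - fuzzy_upper A alpha| < e.
    (* The metric bounds the endpoint distances at all levels at once, so the gauge does not depend
       on [alpha]. *)
    move=> /fA[delta dg dP]; exists delta => // alpha D a01 fD.
    have [<- <-] := fuzzy_riemann_sum_endpoints T a b f D alpha fD.1 a01.
    have [h1 h2] := fuzzy_dist_endpoints (fuzzy_riemann_sum f D) A alpha a01.
    by split; [apply: le_lt_trans h1 _|apply: le_lt_trans h2 _]; exact: dP.
  have hl alpha : 0 <= alpha <= 1 ->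
      has_hk_integral T a b (fun x => fuzzy_lower (f x) alpha)
        (fuzzy_lower A alpha).
    move=> a01 e /key[delta dg dP]; exists delta => // D fD.
    by have [] := dP _ _ a01 fD.
  have hu alpha : 0 <= alpha <= 1 ->
      has_hk_integral T a b (fun x => fuzzy_upper (f x) alpha)
        (fuzzy_upper A alpha).
    move=> a01 e /key[delta dg dP]; exists delta => // D fD.
    by have [] := dP _ _ a01 fD.
  split=> [alpha a01|e /key[delta dg dP]].
    by split; [exists (fuzzy_lower A alpha); exact: hl|
               exists (fuzzy_upper A alpha); exact: hu].
  exists delta => // alpha D a01 fD.
  rewrite (hk_integralE _ _ _ _ _ clT ha hb hab (hl _ a01)).
  rewrite (hk_integralE _ _ _ _ _ clT ha hb hab (hu _ a01)).
  exact: dP.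
set l := fun alpha => hk_integral T a b (fun x => fuzzy_lower (f x) alpha).
set r := fun alpha => hk_integral T a b (fun x => fuzzy_upper (f x) alpha).
have lr : endpoint_family l r.
  apply: endpoint_family_uniform_limit => e /unif[delta dg dP].
  have [D fD] := fine_hk_division_exists T a b delta clT ha hb hab dg.
  (* One division serves every level, so a single fuzzy number approximates both families
     uniformly. *)
  exists (fuzzy_riemann_sum f D) => alpha a01.
  have [-> ->] := fuzzy_riemann_sum_endpoints T a b f D alpha fD.1 a01.
  exact: dP.
have [A Alr] := endpoint_family_fuzzy lr; exists A => e e0.
(* The supremum in the metric only preserves non-strict bounds; [e / 2] restores strictness. *)
have e20 : 0 < e / 2 by rewrite divr_gt0.
have [delta dg dP] := unif _ e20; exists delta => // D fD.
apply: (@le_lt_trans _ _ (e / 2)); last by lra.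
apply: fuzzy_dist_le => alpha a01.
have lralpha : l alpha <= r alpha.
  have [lr1 mono _ _ _] := lr; have /andP[a0 a1] := a01.
  by have [? ?] := mono alpha 1 a0 a1 (lexx 1); lra.
have [-> ->] := fuzzy_endpointsE A alpha _ _ lralpha (Alr _ a01).
have [-> ->] := fuzzy_riemann_sum_endpoints T a b f D alpha fD.1 a01.
by have [/ltW ? /ltW ?] := dP alpha D a01 fD.
Qed.
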